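(* Let $X\subset\mathbb{P}^N$ be an irreducible projective variety over $\mathbb{C}$. Then $\operatorname{Hrk}_X(q)<\infty$ for every point $q\in\mathbb{P}^N$ if and only if $X$ is strongly concise, i.e. for every $i\in\{0,\ldots,N\}$ one has $(X\cap H_i)\not\subset\bigcup_{j\neq i}H_j$.
   Context: Work in $\mathbb{P}^N=\mathbb{P}V$ with fixed coordinates $x_0,\ldots,x_N$. For $p=(p_0:\cdots:p_N)$, $q=(q_0:\cdots:q_N)$, the Hadamard product $p\star q=(p_0q_0:\cdots:p_Nq_N)$ is defined whenever not all $p_iq_i$ are zero. For a variety $X\subset\mathbb{P}^N$, the Hadamard-$X$-rank of $q\in\mathbb{P}^N$ is $\operatorname{Hrk}_X(q)=\min\{m\mid q=p_1\star\cdots\star p_m,\ p_i\in X\}$ (the product being defined), with $\operatorname{Hrk}_X(q)=\infty$ if no such decomposition exists. $H_i=\{x_i=0\}$ denotes the $i$-th coordinate hyperplane.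
   Formalization: The theorem assumes N ≥ 1; for N = 0 the claim fails, since X = P^0 has Hadamard rank 1 at its only point but X ∩ H_0 is empty, hence contained in the empty union, so X is not strongly concise. *)

(* Defs.v *)
From HB Require Import structures.
From mathcomp Require Import all_boot all_order all_algebra.
From mathcomp Require Import reals Rstruct complex.
From mathcomp Require Import mpoly.

Set Implicit Arguments.
Unset Strict Implicit.
Unset Printing Implicit Defensive.

Import GRing.Theory.
Local Open Scope ring_scope.

Definition CC : closedFieldType := (Rdefinitions.R)[i].

Definition coordvec (N : nat) := 'I_N.+1 -> CC.

(* A point of P^N is represented by a nonzero coordinate vector; two vectors
   represent the same point iff they are proportional. *)
Definition nonzero_vec (N : nat) (v : coordvec N) : Prop := exists i, v i != 0.

Definition proj_eq (N : nat) (v w : coordvec N) : Prop :=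
  exists c : CC, c != 0 /\ forall i, v i = c * w i.

(* Subsets of P^N are represented by predicates on coordinate vectors
   (only nonzero vectors matter). *)
Definition projset (N : nat) := coordvec N -> Prop.

Definition homogeneous (N : nat) (p : mpoly.mpoly N.+1 CC) : Prop :=
  exists d : nat, forall m : mpoly.multinom N.+1, m \in mpoly.msupp p -> mpoly.mdeg m = d.

Definition zero_locus (N : nat) (S : mpoly.mpoly N.+1 CC -> Prop) : projset N :=
  fun v => nonzero_vec v /\ forall p, S p -> mpoly.meval v p = 0.

Definition proj_closed (N : nat) (X : projset N) : Prop :=
  exists S : mpoly.mpoly N.+1 CC -> Prop,
    (forall p, S p -> homogeneous p) /\ forall v, X v <-> zero_locus S v.

Definition irreducible_proj_variety (N : nat) (X : projset N) : Prop :=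
  [/\ proj_closed X,
      (exists v, X v)
    & forall Y Z : projset N, proj_closed Y -> proj_closed Z ->
        (forall v, X v -> Y v \/ Z v) ->
        (forall v, X v -> Y v) \/ (forall v, X v -> Z v)].

Definition hadamard (N : nat) (p q : coordvec N) : coordvec N :=
  fun i => p i * q i.

Definition hadamard_seq (N : nat) (p : coordvec N) (s : seq (coordvec N)) :
  coordvec N := foldl (@hadamard N) p s.

(* q = p_1 * ... * p_m  with p_i in X (m >= 1), the product being defined
   (i.e. a nonzero vector), as points of P^N. *)
Definition Hdecomposition (N : nat) (X : projset N) (q : coordvec N)
    (p : coordvec N) (s : seq (coordvec N)) : Prop :=
  [/\ X p, (forall x, List.In x s -> X x),
      nonzero_vec (hadamard_seq p s)
    & proj_eq q (hadamard_seq p s)].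

Definition Hrk_is (N : nat) (X : projset N) (q : coordvec N) (m : nat) : Prop :=
  (exists p s, size s = m.-1 /\ (0 < m)%N /\ Hdecomposition X q p s) /\
  (forall m' p s, size s = m'.-1 -> (0 < m')%N -> Hdecomposition X q p s ->
     (m <= m')%N).

Definition Hrk_finite (N : nat) (X : projset N) (q : coordvec N) : Prop :=
  exists m : nat, Hrk_is X q m.

Definition coord_hyperplane (N : nat) (i : 'I_N.+1) : projset N :=
  fun v => v i = 0.

Definition strongly_concise (N : nat) (X : projset N) : Prop :=
  forall i : 'I_N.+1,
    ~ (forall v, nonzero_vec v -> X v -> coord_hyperplane i v ->
         exists j : 'I_N.+1, j != i /\ coord_hyperplane j v).

(* Main.v *)
Require Import Defs.
From mathcomp Require Import all_boot all_order all_algebra all_field.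
From mathcomp Require Import mpoly.

(** If X is strongly concise, each coordinate i has a point of X whose only zero
    coordinate is the i-th, so it suffices to write every point of the torus as
    a product of points of the torus part Y of X.  Let P_k be the set of
    (k+1)-fold products of points of Y; its vanishing ideal is prime.  Its
    projection to the first k coordinates is Zariski dense, by induction on k:
    otherwise the next coordinate is algebraic over the previous ones, and
    comparing an equation F of P_k of least degree with one of P_(k+1) = Y.P_k
    shows that F(t x) is proportional to F(x) for every t = z / y with y, z in Y,
    so two monomials agree on all such t.  This binomial relation extends to X
    and fails at the point of X whose only zero is a suitable coordinate.  Hence
    P_(N+1) is dense; being definable, it contains a nonempty open set U by
    quantifier elimination, and U.U is the whole torus. *)

Set Implicit Arguments.
Unset Strict Implicit.
Unset Printing Implicit Defensive.
Import Order.Theory GRing.Theory.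
Local Open Scope ring_scope.

Local Notation widen := (widen_ord (leqnSn _)).

(** * Prime vanishing ideals and Hadamard products *)

Section Vanishing.
Variables (F : fieldType) (n : nat).
Implicit Types (P Q : ('I_n -> F) -> Prop) (f g : {mpoly F[n]}) (v w : 'I_n -> F).

Definition vanishes P f := forall v, P v -> f.@[v] = 0.
Definition zdense P := forall f, vanishes P f -> f = 0.
(** Primality of the vanishing ideal, stated for an arbitrary set of points, so that products of
    sets never have to be closed. *)
Definition zirreducible P :=
  forall f g, vanishes P (f * g) -> vanishes P f \/ vanishes P g.
Definition torus v := forall i, v i != 0.
Definition hmul v w : 'I_n -> F := fun i => v i * w i.
Definition hprod P Q v := exists x y, [/\ P x, Q y & v =1 hmul x y].

(** The pullback of [f] under the diagonal action of [v]. *)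
Definition mscale v f : {mpoly F[n]} := f \mPo [tuple v i *: 'X_i | i < n].

Lemma meval_mscale v f w : (mscale v f).@[w] = f.@[hmul v w].
Proof.
rewrite /mscale comp_mpoly_meval; apply: meval_eq => i.
by rewrite tnth_mktuple mevalZ mevalXU.
Qed.

Lemma meval_mscaleC v w f : f.@[hmul v w] = (mscale w f).@[v].
Proof. by rewrite meval_mscale; apply: meval_eq => i; rewrite /hmul mulrC. Qed.

Lemma mcoeff_mscale v f m :
  (mscale v f)@_m = (\prod_i v i ^+ m i) * f@_m.
Proof.
rewrite /mscale comp_mpolyEX raddf_sum /=.
rewrite [in RHS](mpolyE f) raddf_sum mulr_sumr; apply: eq_bigr => m' _ /=.
rewrite [X in _ *: X](_ : _ = (\prod_i v i ^+ m' i) *: 'X_[m']); last first.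
  rewrite comp_mpolyX (mpolyXE_id F m') -scaler_prod; apply: eq_bigr => i _.
  by rewrite tnth_mktuple exprZn.
rewrite !mcoeffZ !mcoeffX; case: eqP => [->|_]; last by rewrite !mulr0.
by rewrite !mulr1 mulrC.
Qed.

Lemma mscaleM v : {morph mscale v : f g / f * g}.
Proof. by move=> f g; rewrite /mscale rmorphM. Qed.

Lemma torus_prod v (m : 'X_{1..n}) : torus v -> \prod_i v i ^+ m i != 0.
Proof. by move=> tv; apply/prodf_neq0 => i _; rewrite expf_neq0. Qed.

Lemma msupp_mscale v f : torus v -> msupp (mscale v f) =i msupp f.
Proof.
move=> tv m; rewrite !mcoeff_msupp mcoeff_mscale mulf_eq0.
by rewrite (negPf (torus_prod _ tv)).
Qed.

Lemma mscale_eq0 v f : torus v -> (mscale v f == 0) = (f == 0).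
Proof.
move=> tv; apply/eqP/eqP => [e|->]; last by rewrite /mscale raddf0.
apply/mpolyP => m; rewrite mcoeff0; apply/eqP.
by rewrite mcoeff_eq0 -(msupp_mscale _ tv) e msupp0.
Qed.

Lemma zdense_sub P Q : (forall v, P v -> Q v) -> zdense P -> zdense Q.
Proof. by move=> PQ dP f vf; apply: dP => v /PQ/vf. Qed.

Lemma not_vanishes P f :
  ~ vanishes P f -> exists v, P v /\ f.@[v] != 0.
Proof.
move=> nv; apply: Classical_Prop.NNPP => no; apply: nv => v Pv.
by apply/eqP/negPn/negP => fv; apply: no; exists v.
Qed.

Lemma zirreducibleP P f g : zirreducible P ->
  (exists v, P v /\ f.@[v] != 0) -> (exists v, P v /\ g.@[v] != 0) ->
  exists v, [/\ P v, f.@[v] != 0 & g.@[v] != 0].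
Proof.
move=> irP [v [Pv fv]] [w [Pw gw]].
have /not_vanishes [u [Pu]] : ~ vanishes P (f * g).
  by case/irP => h; [move: fv; rewrite h ?eqxx | move: gw; rewrite h ?eqxx].
by rewrite mevalM mulf_eq0 negb_or => /andP[fu gu]; exists u.
Qed.

(** The factors are moved one at a time: with the [Q]-factors [y], [y'] fixed, two nonempty open
    subsets of [P] share a point [u]; with [u] fixed, the same happens in [Q]. *)
Lemma zirreducible_hprod P Q :
  zirreducible P -> zirreducible Q -> zirreducible (hprod P Q).
Proof.
move=> irP irQ f g vfg; apply: Classical_Prop.NNPP => /Classical_Prop.not_or_and.
case=> /not_vanishes [v [[x [y [Px Qy e]]] fv]] /not_vanishes [w [[x' [y' [Px' Qy' e']]] gw]].
move: fv gw; rewrite (meval_eq _ e) (meval_eq _ e') !meval_mscaleC => fv gw.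
have [u [Pu fu gu]] : exists u, [/\ P u, (mscale y f).@[u] != 0 & (mscale y' g).@[u] != 0].
  by apply: zirreducibleP => //; [exists x | exists x'].
have [z [Qz fz gz]] : exists z, [/\ Q z, (mscale u f).@[z] != 0 & (mscale u g).@[z] != 0].
  apply: zirreducibleP => //; [exists y | exists y']; split=> //.
    by rewrite meval_mscale meval_mscaleC.
  by rewrite meval_mscale meval_mscaleC.
have := vfg (hmul u z) (ex_intro _ u (ex_intro _ z (And3 Pu Qz (frefl _)))).
by rewrite mevalM -!meval_mscale => /eqP; rewrite mulf_eq0 (negPf fz) (negPf gz).
Qed.

End Vanishing.

Section HadamardInverse.
Variables (F : fieldType) (n : nat).
Implicit Types (f : {mpoly F[n]}) (v w : 'I_n -> F).

Definition hinv v : 'I_n -> F := fun i => (v i)^-1.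

Lemma torus_hinv v : torus v -> torus (hinv v).
Proof. by move=> tv i; rewrite invr_eq0. Qed.

Lemma torus_hmul v w : torus v -> torus w -> torus (hmul v w).
Proof. by move=> tv tw i; rewrite mulf_neq0. Qed.

Lemma prod_hmul v w (m : 'X_{1..n}) :
  \prod_i hmul v w i ^+ m i = (\prod_i v i ^+ m i) * \prod_i w i ^+ m i.
Proof. by rewrite -big_split; apply: eq_bigr => i _; rewrite exprMn. Qed.

Lemma mscale_hmul v w f : mscale v (mscale w f) = mscale (hmul v w) f.
Proof. by apply/mpolyP => m; rewrite !mcoeff_mscale prod_hmul mulrA. Qed.

Lemma mscale_hinvK v f : torus v -> mscale (hinv v) (mscale v f) = f.
Proof.
move=> tv; apply/mpolyP => m; rewrite mscale_hmul mcoeff_mscale.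
rewrite big1 ?mul1r // => i _.
by rewrite /hmul /hinv mulVf ?expr1n.
Qed.

End HadamardInverse.

(** * Polynomials in the last variable *)

Section Univariate.
Variables (F : fieldType) (k : nat).
Implicit Types (f g : {mpoly F[k.+1]}) (q : {poly {mpoly F[k]}}).

Definition mtrunc (m : 'X_{1..k.+1}) : 'X_{1..k} := [multinom m (widen i) | i < k].

Lemma mtruncK (m : 'X_{1..k.+1}) : m = (mnmwiden (mtrunc m) + U_(ord_max) *+ m ord_max)%MM.
Proof.
apply/mnmP => i; rewrite mnmDE mulmnE mnm1E.
have [j ->|->] := unliftP ord_max i; last first.
  by rewrite mnmwiden_ordmax eqxx mul1n.
have -> : lift ord_max j = widen j by apply: val_inj; rewrite /= /bump leqNgt ltn_ord.
rewrite mnmwiden_widen mnmE [_ == _](_ : _ = false) ?addn0 //.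
by apply/negP => /eqP/(congr1 val) /= e; have := ltn_ord j; rewrite -e ltnn.
Qed.

(** The inverse of [muni]: the univariate indeterminate becomes the last variable. *)
Definition munipoly q : {mpoly F[k.+1]} := (map_poly (@mwiden k F) q).['X_ord_max].

Lemma munipolyM : {morph munipoly : p q / p * q}.
Proof. by move=> p q; rewrite /munipoly rmorphM /= hornerM. Qed.

Lemma munipolyD : {morph munipoly : p q / p + q}.
Proof. by move=> p q; rewrite /munipoly rmorphD /= hornerD. Qed.

Lemma munipoly0 : munipoly 0 = 0.
Proof. by rewrite /munipoly rmorph0 horner0. Qed.

Lemma munipolyZ a q : munipoly (a *: q) = mwiden a * munipoly q.
Proof. by rewrite -mul_polyC munipolyM /munipoly map_polyC /= hornerC. Qed.

Lemma muniK : cancel (@muni k F) munipoly.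
Proof.
move=> f; rewrite muniE /munipoly raddf_sum horner_sum [RHS]mpolyE.
apply: eq_bigr => m _ /=.
rewrite -!mul_polyC rmorphM /= map_polyC map_polyXn hornerM hornerC hornerXn /=.
rewrite mwidenZ mwidenX -scalerAl; congr (_ *: _).
by rewrite mpolyXn -mpolyXD -mtruncK.
Qed.

Lemma mcoeff_muni f j (m : 'X_{1..k}) :
  (muni f)`_j@_m = f@_(mnmwiden m + U_(ord_max) *+ j)%MM.
Proof.
rewrite muniE coef_sum raddf_sum [in RHS](mpolyE f) raddf_sum.
apply: eq_bigr => m' _ /=; rewrite coefZ coefXn mcoeffZ mcoeffX.
have E : (m' == (mnmwiden m + U_(ord_max) *+ j)%MM) = (mtrunc m' == m) && (j == m' ord_max).
  apply/eqP/andP => [->|[/eqP<- /eqP->]]; last exact: mtruncK.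
  split; apply/eqP; last first.
    by rewrite mnmDE mulmnE mnmwiden_ordmax mnm1E eqxx mul1n.
  apply/mnmP => i; rewrite mnmE mnmDE mulmnE mnmwiden_widen mnm1E.
  rewrite [_ == _](_ : _ = false) ?addn0 //.
  by apply/negP => /eqP/(congr1 val) /= e; have := ltn_ord i; rewrite -e ltnn.
rewrite E; case: (j == _); rewrite ?mulr1 ?mulr0 ?andbT ?andbF ?mcoeff0 ?mulr0 //.
by rewrite mcoeffZ mcoeffX.
Qed.

(** Reads the degree in the last variable off the support, which torus scalings preserve. *)
Lemma size_muni_le f d :
  reflect (forall m, m \in msupp f -> (m ord_max < d)%N) (size (muni f) <= d)%N.
Proof.
apply: (iffP idP) => [sz m mf | h].
  rewrite ltnNge; apply/negP => dm; move: mf; rewrite mcoeff_msupp.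
  rewrite [m]mtruncK -mcoeff_muni nth_default ?mcoeff0 ?eqxx //.
  exact: leq_trans sz dm.
apply/leq_sizeP => j dj; apply/mpolyP => m; rewrite mcoeff_muni mcoeff0.
apply/eqP; rewrite mcoeff_eq0; apply/negP => /h.
by rewrite mnmDE mulmnE mnmwiden_ordmax mnm1E eqxx mul1n ltnNge dj.
Qed.

Lemma mwiden_muni (a : {mpoly F[k]}) : muni (mwiden a) = a%:P.
Proof.
apply/polyP => j; apply/mpolyP => m; rewrite mcoeff_muni coefC.
case: eqP => [->|/eqP nj]; first by rewrite mulm0n addm0 mwiden_mnmwiden.
rewrite mcoeff0 (mwidenE (leqnn (msize a))) raddf_sum /= big1 // => m' _.
rewrite mcoeffZ mcoeffX; case: eqP => [e|_]; last by rewrite mulr0.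
have := congr1 (fun x : 'X_{1..k.+1} => x ord_max) e.
rewrite /= mnmDE mulmnE !mnmwiden_ordmax mnm1E eqxx mul1n add0n => e0.
by rewrite -e0 eqxx in nj.
Qed.

Lemma muniXmax : muni ('X_ord_max : {mpoly F[k.+1]}) = 'X.
Proof.
rewrite muniE msuppX big_seq1 mcoeffX eqxx scale1r mnm1E eqxx expr1.
rewrite [X in 'X_[X]](_ : _ = 0%MM) ?mpolyX0 ?scale1r //.
apply/mnmP => i; rewrite !mnmE; apply/eqP; rewrite eqb0; apply/negP => /eqP.
by move/(congr1 val) => /= e; have := ltn_ord i; rewrite -e ltnn.
Qed.

Lemma munipolyK : cancel munipoly (@muni k F).
Proof.
move=> q; rewrite /munipoly -horner_map /= muniXmax -map_poly_comp.
rewrite (eq_map_poly (g := polyC)); first exact: comp_polyXr.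
exact: mwiden_muni.
Qed.

Lemma muni_eq0 f : (muni f == 0) = (f == 0).
Proof.
by rewrite -[0 in LHS](raddf0 (@muni k F)) (can_eq muniK).
Qed.

Lemma meval_mwiden (v : 'I_k.+1 -> F) (a : {mpoly F[k]}) :
  (mwiden a).@[v] = a.@[fun i => v (widen i)].
Proof.
rewrite (mwidenE (leqnn (msize a))) [in RHS](mpolywE (leqnn (msize a))) !raddf_sum /=; apply: eq_bigr => m _.
rewrite !mevalZ !mevalX big_ord_recr /= mnmwiden_ordmax expr0 mulr1.
by congr (_ * _); apply: eq_bigr => i _; rewrite mnmwiden_widen.
Qed.

End Univariate.

(** * The density step *)

Lemma ex_minimal (T : Type) (Q : T -> Prop) (mu : T -> nat) :
  (exists x, Q x) -> exists x, Q x /\ forall y, Q y -> (mu x <= mu y)%N.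
Proof.
case=> x; have [d] := ubnP (mu x); elim: d x => // d IH x /ltnSE le_d Qx.
have [[y [Qy lt_yx]]|no] := Classical_Prop.classic (exists y, Q y /\ (mu y < mu x)%N).
  by apply: (IH y) => //; apply: leq_trans lt_yx le_d.
exists x; split=> // y Qy; rewrite leqNgt; apply/negP => lt_yx.
by apply: no; exists y.
Qed.

(** Division over the fraction field with denominators cleared into [a]; the last clause records the
    degrees when the division is exact. *)
Lemma pseudo_division (R : idomainType) (p d : {poly R}) : d != 0 ->
  exists a q r, [/\ a != 0, a *: p = q * d + r, (size r < size d)%N &
    r = 0 -> p != 0 -> q != 0 /\ size p = (size q + size d).-1].
Proof.
move=> nzd; exists (lead_coef d ^+ scalp p d), (p %/ d), (p %% d).
have nza : lead_coef d ^+ scalp p d != 0 by rewrite expf_neq0 ?lead_coef_eq0.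
have e := Pdiv.Idomain.divp_eq p d.
rewrite Pdiv.Idomain.ltn_modp nzd; split=> // r0 nzp.
rewrite r0 addr0 in e.
have nzq : p %/ d != 0.
  apply: contraNneq nzp => q0.
  by move/eqP: e; rewrite q0 mul0r -mul_polyC mulf_eq0 polyC_eq0 (negPf nza).
by split=> //; rewrite -size_mul // -e size_scale.
Qed.

(* Restated with the ring structure inferred for [{mpoly F[k]}], which the
   unifier does not identify with the generic one on large terms. *)
Lemma pseudo_division_mpoly (F : fieldType) k (p d : {poly {mpoly F[k]}}) :
  d != 0 ->
  exists (a : {mpoly F[k]}) (q r : {poly {mpoly F[k]}}), [/\ a != 0, a *: p = q * d + r, (size r < size d)%N &
    r = 0 -> p != 0 -> q != 0 /\ size p = (size q + size d).-1].
Proof. exact: pseudo_division. Qed.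

Lemma size_muni_mscale (F : fieldType) k (v : 'I_k.+1 -> F) (f : {mpoly F[k.+1]}) :
  torus v -> size (muni (mscale v f)) = size (muni f).
Proof.
move=> tv; apply/eqP; rewrite eqn_leq; apply/andP; split; apply/size_muni_le => m.
  rewrite msupp_mscale //; exact/size_muni_le.
rewrite -(msupp_mscale _ tv); exact/size_muni_le.
Qed.

Section DensityStep.
Variables (F : fieldType) (k : nat) (P Y : ('I_k.+1 -> F) -> Prop).
Hypotheses (torusP : forall v, P v -> torus v) (torusY : forall v, Y v -> torus v).
Hypotheses (inhP : exists v, P v) (inhY : exists v, Y v).
Hypothesis irrYP : zirreducible (hprod Y P).
Hypothesis denseP : zdense (fun w => exists2 v, P v & forall i, w i = v (widen i)).

(** A size: one more than the degree in the last variable, and 0 for the zero polynomial. *)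
Local Notation deg f := (size (muni f)).
Implicit Types f g : {mpoly F[k.+1]}.

Let vanishes_scale y f : Y y -> vanishes (hprod Y P) f -> vanishes P (mscale y f).
Proof.
move=> Yy vf v Pv; rewrite meval_mscale; apply: vf.
by exists y, v.
Qed.

(** An equation free of the last variable would vanish on the projection of [P], which is dense. *)
Lemma vanishes_deg_gt1 f : f != 0 -> vanishes P f -> (1 < deg f)%N.
Proof.
move=> nz vf; rewrite ltnNge; apply/negP => /size1_polyC.
set c := _`_0 => e.
have ef : f = mwiden c.
  by apply: (can_inj (@muniK _ _)); rewrite mwiden_muni.
have c0 : c = 0.
  apply: denseP => w [v Pv ew].
  by rewrite (meval_eq _ ew) -meval_mwiden -ef vf.
by move: nz; rewrite ef c0 raddf0 eqxx.
Qed.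

(* If F vanishes on P with least degree in the last variable, and G does so on
   Y.P, then the translate of G by y is, up to a factor free of that variable,
   a multiple of F; as the ideal of Y.P is prime, it contains F(x / y). *)
Lemma vanishes_translate f y :
  f != 0 -> vanishes P f ->
  (forall g, g != 0 -> vanishes P g -> (deg f <= deg g)%N) ->
  ~ zdense (hprod Y P) -> Y y -> vanishes (hprod Y P) (mscale (hinv y) f).
Proof.
move=> nzf vf minf nd Yy; have ty := torusY Yy.
have [G [[nzG vG] minG]] : exists G : {mpoly F[k.+1]}, (G != 0 /\ vanishes (hprod Y P) G) /\
    forall g, g != 0 /\ vanishes (hprod Y P) g -> (deg G <= deg g)%N.
  apply: (@ex_minimal _ _ (fun g => deg g)); apply: Classical_Prop.NNPP => no.
  apply: nd => g vg; apply/eqP/negPn/negP => nzg; apply: no; by exists g.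
have nzf1 : muni f != 0 by rewrite muni_eq0.
have nzg : mscale y G != 0 by rewrite mscale_eq0.
have [a [q [r [nza E szr szq]]]] := pseudo_division_mpoly (muni (mscale y G)) nzf1.
have Ef : mwiden a * mscale y G = munipoly q * f + munipoly r.
  by rewrite -{1}(muniK (mscale y G)) -munipolyZ E munipolyD munipolyM (muniK f).
(* The remainder vanishes on [P] and has smaller degree than [f]. *)
have r0 : r = 0.
  apply/eqP/negPn/negP => nzr.
  have nzr' : munipoly r != 0 by rewrite -muni_eq0 munipolyK.
  suff h : vanishes P (munipoly r).
    by have := minf _ nzr' h; rewrite munipolyK leqNgt szr.
  move=> v Pv; have := congr1 (meval v) Ef.
  rewrite mevalD !mevalM (vf v Pv) (vanishes_scale Yy vG Pv) !mulr0 add0r.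
  by move=> <-.
have [|nzq {}szq] := szq r0; first by rewrite muni_eq0.
rewrite r0 munipoly0 addr0 in Ef.
have E' : mscale (hinv y) (mwiden a) * G =
    mscale (hinv y) (munipoly q) * mscale (hinv y) f.
  by rewrite -mscaleM -Ef mscaleM mscale_hinvK.
case: (irrYP (f := mscale (hinv y) (munipoly q)) (g := mscale (hinv y) f)) => //.
  by move=> v YPv; rewrite -E' mevalM vG // mulr0.
(* The cofactor cannot vanish on Y.P: its degree would be at least that of [G], while [f] has
   positive degree and the degrees of cofactor and [f] add up to that of [G]. *)
move=> vq; have tyi := torus_hinv ty.
have leq_q : (deg G <= size q)%N.
  have e1 : deg (mscale (hinv y) (munipoly q)) = size q.
    by rewrite (size_muni_mscale _ tyi) (munipolyK q).
  rewrite -e1; apply: minG; split; last exact: vq.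
  by rewrite (mscale_eq0 _ tyi) -muni_eq0 (munipolyK q).
have {}szq := etrans (esym (size_muni_mscale G ty)) szq.
have f1_gt1 := vanishes_deg_gt1 nzf vf.
have absurd_size x a' b : (x <= a' -> x = (a' + b).-1 -> 1 < b -> False)%N.
  move=> le_x ex; case: b ex => // -[] // b; rewrite !addnS /= => ex _.
  by move: le_x; rewrite ex ltnNge leq_addr.
by case: (absurd_size _ _ _ leq_q szq f1_gt1).
Qed.

(** The second alternative says that the character with exponent a - b is constant on [Y]. It comes
    from an equation of [P] of least degree with, among those, the fewest monomials. *)
Lemma density_step : zdense (hprod Y P) \/
  exists a b : 'X_{1..k.+1}, a != b /\ forall y z, Y y -> Y z ->
    (\prod_i y i ^+ a i) * (\prod_i z i ^+ b i) =
    (\prod_i z i ^+ a i) * (\prod_i y i ^+ b i).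
Proof.
have [d|nd] := Classical_Prop.classic (zdense (hprod Y P)); [by left | right].
have [y0 Yy0] := inhY.
pose Q (f : {mpoly F[k.+1]}) := f != 0 /\ vanishes P f.
(* [P] has nonzero equations: translate one of Y.P by the point [y0] of [Y]. *)
have [f0 [Qf0 minf0]] : exists f : {mpoly F[k.+1]}, Q f /\ forall g, Q g -> (deg f <= deg g)%N.
  apply: (@ex_minimal _ _ (fun g => deg g)); apply: Classical_Prop.NNPP => no.
  apply: nd => g vg; apply/eqP/negPn/negP => nzg; apply: no.
  exists (mscale y0 g); split; last exact: vanishes_scale.
  by rewrite mscale_eq0 //; exact: torusY.
have [f [[[nzf vf] szf] minf]] : exists f : {mpoly F[k.+1]}, (Q f /\ (deg f <= deg f0)%N) /\
    forall g, Q g /\ (deg g <= deg f0)%N -> (size (msupp f) <= size (msupp g))%N.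
  by apply: (@ex_minimal _ _ (fun g => size (msupp g))); exists f0.
have mindeg g : g != 0 -> vanishes P g -> (deg f <= deg g)%N.
  by move=> nzg vg; apply: leq_trans szf (minf0 g _).
pose m1 := mlead f; have m1f : m1 \in msupp f := mlead_supp nzf.
(* A single monomial has no zero on the torus, so [f] has a second one. *)
have [m2 m2f m12] : exists2 m2, m2 \in msupp f & m1 != m2.
  apply: Classical_Prop.NNPP => no; have [v Pv] := inhP.
  have := vf v Pv; rewrite mevalE (bigD1_seq m1) ?msupp_uniq //=.
  rewrite [X in _ + X]big_seq_cond [X in _ + X]big1.
    rewrite addr0 => /eqP; rewrite mulf_eq0 -[_ == 0]negbK -mcoeff_msupp m1f /=.
    by rewrite (negPf (torus_prod _ (torusP Pv))).
  move=> m /andP[mf nm]; case: no; exists m => //; by rewrite eq_sym.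
exists m1, m2; split=> // y z Yy Yz.
have ty := torusY Yy; have tz := torusY Yz.
pose t := hmul z (hinv y); have tt : torus t by apply: torus_hmul => //; exact: torus_hinv.
(* Scaling by the inverse of [y] carries [f] to an equation of Y.P; scaling by [z] brings that back
   to [P]. *)
have vt : vanishes P (mscale t f).
  rewrite -mscale_hmul; apply: vanishes_scale => //.
  exact: vanishes_translate.
(* The scalar cancels the monomial [m1], so [h] has fewer monomials than [f] and no larger degree;
   by minimality it is zero. *)
pose h : {mpoly F[k.+1]} := mscale t f - (\prod_i t i ^+ m1 i) *: f.
have hE m : h@_m = (\prod_i t i ^+ m i - \prod_i t i ^+ m1 i) * f@_m.
  by rewrite mcoeffB mcoeffZ mcoeff_mscale mulrBl.
have supph m : m \in msupp h -> m \in msupp f /\ m != m1.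
  rewrite !mcoeff_msupp hE mulf_eq0 negb_or subr_eq0 => /andP[n1 ->]; split=> //.
  by apply: contraNneq n1 => ->.
have h0 : h = 0.
  apply/eqP/negPn/negP => nzh.
  have : (size (msupp f) <= size (msupp h))%N.
    apply: minf; split; [split=> // v Pv | apply/size_muni_le => m /supph[mf _]].
      by rewrite mevalB mevalZ vt // vf // mulr0 subr0.
    exact: (elimT (size_muni_le f _) szf).
  rewrite leqNgt => /negP; apply.
  rewrite -(prednK (n := size (msupp f))) ?ltnS; last by case: (msupp f) m1f.
  rewrite -(size_rem m1f); apply: uniq_leq_size; first exact: msupp_uniq.
  by move=> m /supph[mf nm]; rewrite mem_rem_uniq ?msupp_uniq // inE nm.
have := hE m2; rewrite h0 mcoeff0 => /esym/eqP.
rewrite mulf_eq0 -[f@_m2 == 0]negbK -mcoeff_msupp m2f orbF subr_eq0 /t => /eqP.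
have prodV (m : 'X_{1..k.+1}) : \prod_i hinv y i ^+ m i = (\prod_i y i ^+ m i)^-1.
  by rewrite -prodfV; apply: eq_bigr => i _; rewrite exprVn.
rewrite !prod_hmul !prodV => /eqP; rewrite eqr_div ?torus_prod // => /eqP e.
by rewrite mulrC e.
Qed.

End DensityStep.

(** * Finiteness of systems of equations *)

(** Dickson's lemma. Let [s0] settle the first k functions. It also settles every [a] for which
    [c k a] reaches the maximum of [c k] on [s0]; the finitely many lower levels are settled by
    induction, one at a time. *)
Lemma dickson (T : eqType) (c : nat -> T -> nat) (k : nat) (A : T -> Prop) :
  exists s : seq T, {in s, forall b, A b} /\
    forall a, A a -> exists2 b, b \in s & forall i, (i < k)%N -> (c i b <= c i a)%N.
Proof.
elim: k A => [|k IH] A.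
  have [[a Aa]|no] := Classical_Prop.classic (exists a, A a).
    by exists [:: a]; split=> [b|b _]; [rewrite inE => /eqP-> | exists a; rewrite ?mem_head].
  by exists [::]; split=> // a Aa; case: no; exists a.
have [s0 [s0A s0P]] := IH A.
have levels M : exists s : seq T, {in s, forall b, A b} /\
    forall a, A a -> (c k a < M)%N ->
    exists2 b, b \in s & forall i, (i < k.+1)%N -> (c i b <= c i a)%N.
  elim: M => [|M [s [sA sP]]]; first by exists [::].
  have [s' [s'A s'P]] := IH (fun a => A a /\ c k a = M).
  exists (s ++ s'); split=> [b|a Aa].
    by rewrite mem_cat => /orP[/sA|/s'A[]].
  rewrite ltnS leq_eqVlt => /orP[/eqP caM|/(sP a Aa)[b bs bP]].
    have [b bs bP] := s'P a (conj Aa caM).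
    exists b => [|i]; first by rewrite mem_cat bs orbT.
    by rewrite ltnS leq_eqVlt => /orP[/eqP->|/bP//]; rewrite (s'A b bs).2 caM.
  by exists b => //; rewrite mem_cat bs.
have [s [sA sP]] := levels (\max_(b <- s0) c k b).
exists (s ++ s0); split=> [b|a Aa]; first by rewrite mem_cat => /orP[/sA|/s0A].
have [/(sP a Aa)[b bs bP]|leM] := ltnP (c k a) (\max_(b <- s0) c k b).
  by exists b => //; rewrite mem_cat bs.
have [b bs bP] := s0P a Aa; exists b => [|i]; first by rewrite mem_cat bs orbT.
rewrite ltnS leq_eqVlt => /orP[/eqP->|/bP//].
exact: leq_trans (leq_bigmax_seq b bs isT) leM.
Qed.

Lemma dickson_multinom n (A : 'X_{1..n} -> Prop) :
  exists s : seq 'X_{1..n}, {in s, forall b, A b} /\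
    forall a, A a -> exists2 b, b \in s & (b <= a)%MM.
Proof.
pose c i (m : 'X_{1..n}) := if insub i is Some j then m j else 0%N.
have [s [sA sP]] := dickson c n A; exists s; split=> // a /sP[b bs bP].
exists b => //; apply/mnm_lepP => i.
by have := bP i (ltn_ord i); rewrite /c valK.
Qed.

Section Noether.
Variables (F : fieldType) (n : nat).
Implicit Types (f g : {mpoly F[n]}) (s : seq {mpoly F[n]}).

Lemma reduce_mlead f g : f != 0 -> g != 0 -> (mlead g <= mlead f)%MM ->
  exists h, f - h * g = 0 \/ (mlead (f - h * g) < mlead f)%O.
Proof.
move=> nzf nzg legf.
exists ((mleadc f / mleadc g) *: 'X_[mlead f - mlead g]).
set h := _ *: _; set q := f - h * g.
have nzX : 'X_[mlead f - mlead g] != 0 :> {mpoly F[n]}.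
  by apply/eqP => /(congr1 (mcoeff (mlead f - mlead g)%MM))/eqP; rewrite mcoeffX eqxx mcoeff0 oner_eq0.
have nzc : mleadc f / mleadc g != 0 by rewrite mulf_neq0 ?invr_eq0 ?mleadc_eq0.
have nzh : h != 0.
  apply/eqP => /(congr1 (mcoeff (mlead f - mlead g)%MM))/eqP.
  by rewrite mcoeffZ mcoeffX eqxx mulr1 mcoeff0 (negPf nzc).
have leadh : mlead h = (mlead f - mlead g)%MM.
  by rewrite mleadZ_proper mleadXm // mcoeffX eqxx mulr1.
have leadhg : mlead (h * g) = mlead f by rewrite mleadM // leadh submK.
have coef_q : q@_(mlead f) = 0.
  rewrite mcoeffB -leadhg mleadM // mleadcM leadh mcoeffZ mcoeffX eqxx mulr1.
  by rewrite submK // divfK ?mleadc_eq0 // subrr.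
have [->|nzq] := eqVneq q 0; [by left | right].
rewrite lt_neqAle; apply/andP; split.
  by apply: contraNneq nzq => e; rewrite -mleadc_eq0 e coef_q.
apply: le_trans (mleadB_le _ _) _.
by rewrite leadhg leUx lexx.
Qed.

(** The basis theorem for zero loci. Dickson's lemma is applied to the leading monomials of the set
    [I] of polynomials that vanish wherever some finite part of [S] does. *)
Lemma finite_equations (S : {mpoly F[n]} -> Prop) :
  exists s, {in s, forall p, S p} /\
    forall v, {in s, forall p, p.@[v] = 0} -> forall p, S p -> p.@[v] = 0.
Proof.
pose I f := exists s, {in s, forall p, S p} /\
  forall v, {in s, forall p, p.@[v] = 0} -> f.@[v] = 0.
have [ms [msA msP]] :=
  dickson_multinom (fun m => exists f, [/\ f != 0, I f & mlead f = m]).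
have [s [sS sms]] : exists s, {in s, forall p, S p} /\
    {in ms, forall m, exists g, [/\ g != 0, mlead g = m &
      forall v, {in s, forall p, p.@[v] = 0} -> g.@[v] = 0]}.
  elim: ms msA {msP} => [_|m ms IH msA]; first by exists [::].
  have [|s [sS sms]] := IH; first by move=> m' m'ms; apply: msA; rewrite inE m'ms orbT.
  have [g [nzg [s' [s'S s'g]] leadg]] := msA m (mem_head _ _).
  exists (s ++ s'); split=> [p|m']; first by rewrite mem_cat => /orP[/sS|/s'S].
  rewrite inE => /orP[/eqP->|/sms[g' [nzg' leadg' s'g']]].
    by exists g; split=> // v vs; apply: s'g => p ps'; apply: vs; rewrite mem_cat ps' orbT.
  by exists g'; split=> // v vs; apply: s'g' => p ps; apply: vs; rewrite mem_cat ps.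
have Is f : I f -> forall v, {in s, forall p, p.@[v] = 0} -> f.@[v] = 0.
  (* Subtracting a multiple of one of the chosen [g] lowers the leading monomial and stays in
     [I]. *)
  elim/mleadrect: f => f IH If v vs.
  have [->|nzf] := eqVneq f 0; first by rewrite meval0.
  have [m /sms[g [nzg leadg sg]] lem] := msP _ (ex_intro _ f (And3 nzf If erefl)).
  have [h fhg] : exists h, f - h * g = 0 \/ (mlead (f - h * g) < mlead f)%O.
    by apply: reduce_mlead; rewrite ?leadg.
  suff : (f - h * g).@[v] = 0 by rewrite mevalB mevalM sg // mulr0 subr0.
  case: fhg => [->|ltf]; first by rewrite meval0.
  apply: IH => //; have [s' [s'S s'f]] := If.
  exists (s' ++ s); split=> [p|w ws]; first by rewrite mem_cat => /orP[/s'S|/sS].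
  rewrite mevalB mevalM s'f ?sg ?mulr0 ?subr0 // => p ps; apply: ws;
    by rewrite mem_cat ps ?orbT.
exists s; split=> // v vs p Sp; apply: Is vs => //.
exists [:: p]; split=> [q|w ws]; first by rewrite inE => /eqP->.
by apply: ws; rewrite mem_head.
Qed.

End Noether.

(** * Definable sets *)

Section Definable.
Variables (F : closedFieldType) (n : nat).
Implicit Types (e : seq F) (v x y : 'I_n -> F) (p : {mpoly F[n]}).

(** [rformula] excludes inverses, as quantifier elimination over closed fields requires. *)
Definition definable (D : seq F -> Prop) :=
  exists f : GRing.formula F, GRing.rformula f /\ forall e, D e <-> GRing.holds e f.

(** Variables from index n on become 0, the default value read past the end of [codom v]; the value
    at [Inv] is a dummy, as only ring terms are evaluated. *)
Fixpoint mpoly_of_term (t : GRing.term F) : {mpoly F[n]} :=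
  match t with
  | GRing.Var i => if insub i is Some j then 'X_j else 0
  | GRing.Const x => x%:MP
  | GRing.NatConst k => k%:R
  | GRing.Add t1 t2 => mpoly_of_term t1 + mpoly_of_term t2
  | GRing.Opp t1 => - mpoly_of_term t1
  | GRing.NatMul t1 k => mpoly_of_term t1 *+ k
  | GRing.Mul t1 t2 => mpoly_of_term t1 * mpoly_of_term t2
  | GRing.Inv _ => 0
  | GRing.Exp t1 k => mpoly_of_term t1 ^+ k
  end.

Lemma nth_codom_ord v (j : 'I_n) : (codom v)`_j = v j.
Proof. by rewrite (nth_map j) ?size_enum_ord // nth_ord_enum. Qed.

Lemma meval_mpoly_of_term t v : GRing.rterm t ->
  (mpoly_of_term t).@[v] = GRing.eval (codom v) t.
Proof.
elim: t => //=.
- move=> i _; case: insubP => [j _ <-|].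
    by rewrite mevalXU nth_codom_ord.
  by rewrite -leqNgt => le_n_i; rewrite nth_default ?meval0 // size_codom card_ord.
- by move=> x _; rewrite mevalC.
- by move=> k _; rewrite rmorph_nat.
- by move=> t1 IH1 t2 IH2 /andP[r1 r2]; rewrite mevalD IH1 ?IH2.
- by move=> t1 IH1 r1; rewrite mevalN IH1.
- by move=> t1 IH1 k r1; rewrite mevalMn IH1.
- by move=> t1 IH1 t2 IH2 /andP[r1 r2]; rewrite mevalM IH1 ?IH2.
- by move=> t1 IH1 k r1; rewrite rmorphXn /= IH1.
Qed.

(** An equation is either an identity or fails off a hypersurface; connectives are handled off the
    union of the two hypersurfaces. *)
Lemma qf_generic (f : GRing.formula F) : GRing.qf_form f && GRing.rformula f ->
  exists2 g : {mpoly F[n]}, g != 0 &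
    exists b, forall v, g.@[v] != 0 -> GRing.qf_eval (codom v) f = b.
Proof.
have mul2 (op : bool -> bool -> bool) (f1 f2 : GRing.formula F) :
  (exists2 g : {mpoly F[n]}, g != 0 &
    exists b, forall v, g.@[v] != 0 -> GRing.qf_eval (codom v) f1 = b) ->
  (exists2 g : {mpoly F[n]}, g != 0 &
    exists b, forall v, g.@[v] != 0 -> GRing.qf_eval (codom v) f2 = b) ->
  exists2 g : {mpoly F[n]}, g != 0 & exists b, forall v, g.@[v] != 0 ->
    op (GRing.qf_eval (codom v) f1) (GRing.qf_eval (codom v) f2) = b.
  move=> [g1 nz1 [b1 P1]] [g2 nz2 [b2 P2]]; exists (g1 * g2); first by rewrite mulf_neq0.
  exists (op b1 b2) => v; rewrite mevalM mulf_eq0 negb_or => /andP[v1 v2].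
  by rewrite P1 ?P2.
elim: f => //=.
- by move=> b _; exists 1; [exact: oner_neq0 | exists b].
- move=> t1 t2 /andP[r1 r2]; pose g := mpoly_of_term t1 - mpoly_of_term t2.
  have gE v : (GRing.eval (codom v) t1 == GRing.eval (codom v) t2) = (g.@[v] == 0).
    by rewrite mevalB !meval_mpoly_of_term // subr_eq0.
  have [g0|nzg] := eqVneq g 0.
    by exists 1; [exact: oner_neq0 | exists true => v _; rewrite gE g0 meval0 eqxx].
  by exists g => //; exists false => v /negPf; rewrite gE.
- move=> f1 IH1 f2 IH2 /andP[/andP[q1 q2] /andP[r1 r2]].
  by apply: (mul2 andb); [apply: IH1; rewrite q1 | apply: IH2; rewrite q2].
- move=> f1 IH1 f2 IH2 /andP[/andP[q1 q2] /andP[r1 r2]].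
  by apply: (mul2 orb); [apply: IH1; rewrite q1 | apply: IH2; rewrite q2].
- move=> f1 IH1 f2 IH2 /andP[/andP[q1 q2] /andP[r1 r2]].
  by apply: (mul2 implb); [apply: IH1; rewrite q1 | apply: IH2; rewrite q2].
- move=> f1 IH1 /IH1[g nzg [b gP]]; exists g => //.
  by exists (~~ b) => v /gP->.
Qed.

Lemma definable_generic (D : seq F -> Prop) : definable D ->
  exists2 g : {mpoly F[n]}, g != 0 &
    (forall v, g.@[v] != 0 -> D (codom v)) \/ (forall v, g.@[v] != 0 -> ~ D (codom v)).
Proof.
move=> [f [rf fP]].
have elimP := GRing.quantifier_elim_rformP (@ClosedFieldQE.wf_ex_elim F)
  (ClosedFieldQE.holds_ex_elim (@GRing.solve_monicpoly F)).
have := GRing.quantifier_elim_wf (@ClosedFieldQE.wf_ex_elim F) rf.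
case/qf_generic => g nzg [b gP]; exists g => //.
by case: b gP => gP; [left | right] => v /gP gv; [apply/fP | move/fP];
  apply/elimP => //; rewrite gv.
Qed.

Lemma definable_iff (D E : seq F -> Prop) :
  (forall e, D e <-> E e) -> definable D -> definable E.
Proof. by move=> DE [f [rf fP]]; exists f; split=> // e; rewrite -DE. Qed.

Lemma definable_and (D E : seq F -> Prop) :
  definable D -> definable E -> definable (fun e => D e /\ E e).
Proof.
move=> [f [rf fP]] [g [rg gP]]; exists (GRing.And f g); rewrite /= rf rg.
by split=> // e; rewrite fP gP.
Qed.

Lemma definable_not (D : seq F -> Prop) : definable D -> definable (fun e => ~ D e).
Proof.
by move=> [f [rf fP]]; exists (GRing.Not f); split=> // e; rewrite fP.
Qed.

Lemma definable_all (T : eqType) (s : seq T) (D : T -> seq F -> Prop) :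
  (forall a, definable (D a)) -> definable (fun e => {in s, forall a, D a e}).
Proof.
move=> dD; elim: s => [|a s IH].
  by exists (GRing.Bool true); split=> // e.
apply: definable_iff (definable_and (dD a) IH) => e; split=> [[Da Ds] x|Ds].
  by rewrite inE => /orP[/eqP->|/Ds].
by split=> [|x xs]; apply: Ds; rewrite inE ?eqxx ?xs ?orbT.
Qed.

(** Points occupy n consecutive variables, so that one environment can hold a product and its
    factors side by side. *)
Definition block off e : 'I_n -> F := fun i => e`_(off + i).

(** The length is a maximum because a block written past the end of [e] must be preceded by padding
    zeros. *)
Definition set_block off x e : seq F :=
  mkseq (fun j => if insub (j - off)%N is Some i then
                    if (off <= j)%N then x i else e`_j else e`_j)
        (maxn (size e) (off + n)).

Lemma nth_set_block off x e j : (set_block off x e)`_j =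
  if insub (j - off)%N is Some i then if (off <= j)%N then x i else e`_j else e`_j.
Proof.
have [lt_j|le_j] := ltnP j (maxn (size e) (off + n)); first by rewrite nth_mkseq.
rewrite nth_default ?size_mkseq //.
have [le1 le2] : (size e <= j /\ off + n <= j)%N.
  by apply/andP; rewrite -geq_max.
case: insubP => [i lt_i _|_]; last by rewrite nth_default.
by move: lt_i; rewrite ltn_subLR ?(leq_trans _ le2) ?leq_addr // ltnNge le2.
Qed.

Lemma block_set_block off x e : block off (set_block off x e) = x.
Proof.
apply: FunctionalExtensionality.functional_extensionality => i.
by rewrite /block nth_set_block addKn valK leq_addr.
Qed.

Lemma block_set_block_lt off off' x e : (off' + n <= off)%N ->
  block off' (set_block off x e) = block off' e.
Proof.
move=> le_off; apply: FunctionalExtensionality.functional_extensionality => i.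
rewrite /block nth_set_block leqNgt.
have -> /= : (off' + i < off)%N by apply: leq_trans le_off; rewrite ltn_add2l.
by case: insub.
Qed.

Lemma definable_ex_block off (D : seq F -> Prop) : definable D ->
  definable (fun e => exists x, D (set_block off x e)).
Proof.
move=> [f [rf fP]]; exists (foldr (fun i => GRing.Exists i) f (iota off n)).
split=> [|e]; first by elim: (iota off n).
split=> [[x Dx]|/GRing.foldExistsP[e' ee' /fP De']].
  apply/GRing.foldExistsP; exists (set_block off x e); last exact/fP.
  move=> j; rewrite inE /= mem_iota negb_and -leqNgt => jP.
  rewrite nth_set_block; case: insubP => // i lt_i _.
  case: leqP jP => //= le_j jP.
  by move: lt_i; rewrite ltn_subLR // ltnNge jP.
exists (block off e'); apply/fP; apply: GRing.eq_holds (proj1 (fP _) De') => j.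
rewrite nth_set_block; case: insubP => [i lt_i ei|no].
  case: leqP => [le_j|lt_j]; first by rewrite /block ei subnKC.
  by rewrite ee' // inE /= mem_iota leqNgt lt_j.
rewrite ee' // inE /= mem_iota negb_and; have [le_j|//] := leqP off j.
by move: no; rewrite ltn_subLR.
Qed.

Lemma definable_meval off p : definable (fun e => p.@[block off e] = 0).
Proof.
pose mon (m : 'X_{1..n}) := \big[GRing.Mul/GRing.NatConst F 1]_(i < n)
  GRing.Exp (GRing.Var F (off + i)) (m i).
pose t := \big[GRing.Add/GRing.NatConst F 0]_(m <- msupp p)
  GRing.Mul (GRing.Const p@_m) (mon m).
exists (GRing.Equal t (GRing.NatConst F 0)); split=> [|e] /=.
  rewrite andbT /t; elim/big_rec: _ => // m t' _ /= ->; rewrite andbT.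
  by rewrite /mon; elim/big_rec: _.
suff -> : GRing.eval e t = p.@[block off e] by [].
rewrite /t (big_morph (GRing.eval e) (id1 := 0) (op1 := +%R)) // mevalE.
apply: eq_bigr => m _ /=; congr (_ * _).
by rewrite /mon (big_morph (GRing.eval e) (id1 := 1) (op1 := *%R)).
Qed.

Lemma definable_hprod (P Q : ('I_n -> F) -> Prop) :
  (forall off, definable (fun e => P (block off e))) ->
  (forall off, definable (fun e => Q (block off e))) ->
  forall off, definable (fun e => hprod P Q (block off e)).
Proof.
move=> dP dQ off.
have dM (off1 off2 : nat) : definable (fun e => {in enum 'I_n, forall i,
    block off e i = hmul (block off1 e) (block off2 e) i}).
  apply: definable_all => i.
  exists (GRing.Equal (GRing.Var F (off + i))
    (GRing.Mul (GRing.Var F (off1 + i)) (GRing.Var F (off2 + i)))).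
  by split.
(* The two factors are quantified in the two blocks that follow the block of the product, which
   stays untouched. *)
have := definable_ex_block (off + n) (definable_ex_block (off + n + n)
  (definable_and (dM (off + n)%N (off + n + n)%N)
    (definable_and (dP (off + n)%N) (dQ (off + n + n)%N)))).
apply: definable_iff => e.
pose e2 x y := set_block (off + n + n) y (set_block (off + n) x e).
have E1 x y : block off (e2 x y) = block off e.
  by rewrite !block_set_block_lt // -addnA leq_add2l leq_addl.
have E2 x y : block (off + n) (e2 x y) = x.
  by rewrite block_set_block_lt // block_set_block.
have E3 x y : block (off + n + n) (e2 x y) = y by rewrite block_set_block.
split=> [[x [y]]|[x [y [Px Qy e_xy]]]].
  rewrite -/(e2 x y) E1 E2 E3 => -[eM [Px Qy]]; exists x, y; split=> // i.
  by apply: eM; rewrite mem_enum.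
by exists x, y; rewrite -/(e2 x y) E1 E2 E3; split=> // i _.
Qed.

End Definable.

(** * Polynomials on lines through the origin *)

Section Cone.
Variables (F : fieldType) (n : nat).
Implicit Types (f g : {mpoly F[n]}) (z : 'I_n -> F).

(** The restriction of [f] to the line spanned by [z]; its coefficients are the values at [z] of the
    homogeneous components. *)
Definition cone_poly z f : {poly F} :=
  \sum_(m <- msupp f) (f@_m * \prod_i z i ^+ m i) *: 'X^(mdeg m).

Lemma prod_scale c z (m : 'X_{1..n}) :
  \prod_i (c * z i) ^+ m i = c ^+ mdeg m * \prod_i z i ^+ m i.
Proof.
rewrite mdegE -prodrXr -big_split; apply: eq_bigr => i _.
by rewrite exprMn.
Qed.

Lemma horner_cone_poly z f c : (cone_poly z f).[c] = f.@[fun i => c * z i].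
Proof.
rewrite horner_sum mevalE; apply: eq_bigr => m _.
by rewrite hornerZ hornerXn prod_scale -mulrA [c ^+ _ * _]mulrC.
Qed.

Lemma coef_cone_poly z f d : (cone_poly z f)`_d = (pihomog mdeg d f).@[z].
Proof.
rewrite coef_sum pihomogE raddf_sum /= [RHS]big_mkcond; apply: eq_bigr => m _.
rewrite coefZ coefXn eq_sym; case: eqP; rewrite ?mulr0 // mulr1.
by rewrite mevalZ mevalX.
Qed.

Lemma meval_homog_scale f d c z : {in msupp f, forall m, mdeg m = d} ->
  f.@[fun i => c * z i] = c ^+ d * f.@[z].
Proof.
move=> hf; rewrite !mevalE mulr_sumr big_seq [RHS]big_seq; apply: eq_bigr => m mf.
by rewrite prod_scale hf // mulrCA.
Qed.

End Cone.

(** * Hadamard powers in the torus *)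

Section HadamardPowers.
Variables (F : fieldType) (n : nat) (X : ('I_n -> F) -> Prop).

(** The set P_k of the overview: k + 1 factors, not k. *)
Fixpoint hpow k := if k is k'.+1 then hprod X (hpow k') else X.

Hypothesis torusX : forall v, X v -> torus v.
Hypothesis inhX : exists v, X v.
Hypothesis irrX : zirreducible X.

Lemma hpow_torus k v : hpow k v -> torus v.
Proof.
elim: k v => [|k IH] v; first exact: torusX.
by case=> x [y [/torusX tx /IH ty e]] i; rewrite e; apply: torus_hmul.
Qed.

Lemma hpow_inh k : exists v, hpow k v.
Proof.
elim: k => [|k [v Xv]]; first exact: inhX.
by have [x Xx] := inhX; exists (hmul x v), x, v.
Qed.

Lemma zirreducible_hpow k : zirreducible (hpow k).
Proof. by elim: k => [|k IH] //; apply: zirreducible_hprod. Qed.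

Definition restrict k (le_kn : (k <= n)%N) (P : ('I_n -> F) -> Prop) (w : 'I_k -> F) :=
  exists2 v, P v & forall i, w i = v (widen_ord le_kn i).

Definition mlift k (le_kn : (k <= n)%N) (f : {mpoly F[k]}) : {mpoly F[n]} :=
  f \mPo [tuple 'X_(widen_ord le_kn i) | i < k].

Lemma meval_mlift k (le_kn : (k <= n)%N) f v :
  (mlift le_kn f).@[v] = f.@[fun i => v (widen_ord le_kn i)].
Proof.
by rewrite comp_mpoly_meval; apply: meval_eq => i; rewrite tnth_mktuple mevalXU.
Qed.

Hypothesis no_binomial : forall k (le_kn : (k <= n)%N) (a b : 'X_{1..k}), a != b ->
  ~ (forall y z, X y -> X z ->
      (\prod_i y (widen_ord le_kn i) ^+ a i) * (\prod_i z (widen_ord le_kn i) ^+ b i) =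
      (\prod_i z (widen_ord le_kn i) ^+ a i) * (\prod_i y (widen_ord le_kn i) ^+ b i)).

(** Each new coordinate costs one more factor: [density_step] applies to the projections of [X] and
    of [hpow k] to k + 1 coordinates, and [no_binomial] rules out its second alternative. *)
Lemma zdense_restrict_hpow k (le_kn : (k <= n)%N) : zdense (restrict le_kn (hpow k)).
Proof.
elim: k le_kn => [|k IH] le_kn.
  move=> f vf; have [v Xv] := inhX.
  have fC : f = (f@_0%MM)%:MP.
    apply/mpolyP => m; rewrite mcoeffC (_ : m = 0%MM) ?eqxx ?mulr1 //.
    by apply/mnmP => -[].
  have := vf _ (ex_intro2 _ _ v Xv (fun=> erefl)).
  by rewrite fC mevalC => ->; rewrite mpolyC0.
set Y := restrict le_kn X; set P := restrict le_kn (hpow k).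
have YP w : hprod Y P w -> restrict le_kn (hpow k.+1) w.
  case=> x [y [[v Xv ev] [u Pu eu] e]].
  by exists (hmul v u); [exists v, u | move=> i; rewrite e /hmul ev eu].
(* Equations of a projection are pulled back along it, so irreducibility passes to the
   projection. *)
have lift_vanishes f : vanishes (hprod Y P) f <-> vanishes (hpow k.+1) (mlift le_kn f).
  split=> vf v; last first.
    by case/YP => u /vf; rewrite meval_mlift => <- e; apply: meval_eq.
  case=> x [y [Xx Py e]]; rewrite meval_mlift; apply: vf.
  exists (fun i => x (widen_ord le_kn i)), (fun i => y (widen_ord le_kn i)).
  by split; [exists x | exists y | move=> i; rewrite e].
apply: (@zdense_sub _ _ (hprod Y P)) => //.
have [||||||//|[a [b [neq_ab rel]]]] := @density_step F k P Y.
- by move=> w [v /hpow_torus tv e] i; rewrite e.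
- by move=> w [v /torusX tv e] i; rewrite e.
- by have [v Pv] := hpow_inh k; exists (fun i => v (widen_ord le_kn i)), v.
- by have [v Pv] := inhX; exists (fun i => v (widen_ord le_kn i)), v.
- move=> f g /lift_vanishes; rewrite /mlift rmorphM => /zirreducible_hpow.
  by case=> /lift_vanishes; [left | right].
- apply: zdense_sub (IH (ltnW le_kn)) => w [v Pv e].
  exists (fun i => v (widen_ord le_kn i)); first by exists v.
  by move=> i; rewrite e; congr v; apply: val_inj.
case: (no_binomial (le_kn := le_kn) neq_ab) => y z Xy Xz.
by apply: (rel (fun i => y (widen_ord le_kn i)) (fun i => z (widen_ord le_kn i)));
  [exists y | exists z].
Qed.

Lemma zdense_hpow : zdense (hpow n).
Proof.
have d := @zdense_restrict_hpow n (leqnn n); move=> f vf; apply: d => w [v Pv e].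
rewrite (meval_eq _ (v2 := v)) ?vf // => i; rewrite e; congr v; exact: val_inj.
Qed.

(* The polynomial [u |-> g(q / u)], cleared of its denominators. *)
Definition mreflect (q : 'I_n -> F) (g : {mpoly F[n]}) : {mpoly F[n]} :=
  \sum_(m <- msupp g) (g@_m * \prod_i q i ^+ m i) *:
    'X_[[multinom (msize g - m i)%N | i < n]].

Lemma meval_mreflect q g u : torus u ->
  (mreflect q g).@[u] = (\prod_i u i ^+ msize g) * g.@[hmul q (hinv u)].
Proof.
move=> tu; rewrite raddf_sum mevalE mulr_sumr /= big_seq [RHS]big_seq.
apply: eq_bigr => m mg; rewrite mevalZ mevalX mulrCA -mulrA; congr (_ * _).
rewrite -!big_split /=; apply: eq_bigr => i _; rewrite mnmE.
have le_m : (m i <= msize g)%N.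
  by apply: leq_trans (ltnW (msize_mdeg_lt mg)); rewrite mdegE (bigD1 i) //= leq_addr.
rewrite exprMn exprVn expfB_cond; last by rewrite (negPf (tu i)).
by rewrite mulrCA.
Qed.

(** The open set U where [g] is nonzero and its reflection q/U meet in a torus point u, by density;
    then q is the product of u and q/u, both in U. *)
Lemma open_sq_torus (g : {mpoly F[n]}) :
  g != 0 -> (forall v, g.@[v] != 0 -> hpow n v) ->
  forall q, torus q -> hprod (hpow n) (hpow n) q.
Proof.
move=> nzg gX q tq.
have [w [Pw gw]] : exists w, hpow n w /\ g.@[w] != 0.
  by apply: not_vanishes => /zdense_hpow g0; rewrite g0 eqxx in nzg.
have tw := hpow_torus Pw.
have qK u : torus u -> hmul q (hinv (hmul q (hinv u))) =1 u.
  by move=> tu i; rewrite /hmul /hinv invfM invrK mulVKf.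
have tqV u : torus u -> torus (hmul q (hinv u)).
  by move=> tu; apply: torus_hmul => //; apply: torus_hinv.
(* At q/w its value is a nonzero multiple of g(w). *)
have nzr : mreflect q g != 0.
  apply/eqP => /(congr1 (meval (hmul q (hinv w))))/eqP; rewrite meval0.
  rewrite meval_mreflect; last exact: tqV.
  rewrite (meval_eq _ (qK w tw)) mulf_eq0 (negPf gw) orbF.
  by apply/negP/prodf_neq0 => i _; rewrite expf_neq0 // tqV.
have [u [Pu]] : exists u, hpow n u /\ (g * mreflect q g).@[u] != 0.
  by apply: not_vanishes => /zdense_hpow/eqP; rewrite mulf_eq0 (negPf nzg) (negPf nzr).
have tu := hpow_torus Pu.
rewrite mevalM meval_mreflect // !mulf_eq0 !negb_or => /and3P[gu _ gv].
exists u, (hmul q (hinv u)); split=> //; first exact: gX.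
by move=> i; rewrite /hmul /hinv mulrCA divff ?mulr1.
Qed.

End HadamardPowers.

Lemma torus_sq_hpow (F : closedFieldType) n (X : ('I_n -> F) -> Prop) :
  (forall v, X v -> torus v) -> (exists v, X v) -> zirreducible X ->
  (forall k (le_kn : (k <= n)%N) (a b : 'X_{1..k}), a != b ->
  ~ (forall y z, X y -> X z ->
      (\prod_i y (widen_ord le_kn i) ^+ a i) * (\prod_i z (widen_ord le_kn i) ^+ b i) =
      (\prod_i z (widen_ord le_kn i) ^+ a i) * (\prod_i y (widen_ord le_kn i) ^+ b i))) ->
  (forall off, definable (fun e => X (block off e))) ->
  forall q, torus q -> hprod (hpow X n) (hpow X n) q.
Proof.
move=> tX iX irrX noX defX.
have dX := zdense_hpow tX iX irrX noX.
have defP k off : definable (fun e => hpow X k (@block F n off e)).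
  elim: k off => [|k IH] off; first exact: defX.
  exact: definable_hprod.
have blockE v : block 0 (codom v) = v :> ('I_n -> F).
  apply: FunctionalExtensionality.functional_extensionality => i.
  by rewrite /block add0n nth_codom_ord.
have [g nzg [gP|gP]] := @definable_generic F n _ (defP n 0%N).
  apply: (open_sq_torus tX iX irrX noX nzg) => v /gP.
  by rewrite blockE.
(* If the power missed the open set, [g] would vanish on a dense set. *)
case/eqP: nzg; apply: dX => v Pv; apply/eqP/negPn/negP => /gP.
by rewrite blockE.
Qed.

(** * The torus part of a strongly concise set *)

Lemma exists_neq_ord n (i : 'I_n.+2) : exists j, j != i.
Proof.
have [->|] := eqVneq i ord0; last by rewrite eq_sym; exists ord0.
by exists ord_max.
Qed.

Section TorusPart.
Variables (F : closedFieldType) (n : nat) (X : ('I_n.+2 -> F) -> Prop).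
Hypothesis irrX : zirreducible X.
Hypothesis conciseX : forall i : 'I_n.+2,
  exists v, [/\ X v, v i = 0 & forall j, j != i -> v j != 0].
Implicit Types (f g : {mpoly F[n.+2]}) (v : 'I_n.+2 -> F).

Definition torus_part v := X v /\ torus v.

Let h : {mpoly F[n.+2]} := \prod_i 'X_i.

Let torus_h v : torus v <-> h.@[v] != 0.
Proof.
rewrite rmorph_prod /=; split=> [tv|/prodf_neq0 hv i].
  by apply/prodf_neq0 => i _; rewrite mevalXU.
by have := hv i isT; rewrite mevalXU.
Qed.

(** No coordinate vanishes on all of [X], since some point has its only zero elsewhere; by primality
    neither does the product of the coordinates. *)
Lemma torus_part_inh : exists v, torus_part v.
Proof.
suff : ~ vanishes X h.
  by case/not_vanishes => v [Xv /torus_h tv]; exists v.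
rewrite /h; elim/big_rec: _ => [v1|i p _ IH /irrX[vi|//]].
  have [v [Xv _ _]] := conciseX ord0; have /eqP := v1 v Xv.
  by rewrite meval1 oner_eq0.
have [j ji] := exists_neq_ord i; have [v [Xv _ vj]] := conciseX j.
by have /eqP := vi v Xv; rewrite mevalXU (negPf (vj i _)) // eq_sym.
Qed.

(** Multiplying by the product [h] of the coordinates kills the rest of [X]; primality then removes
    [h]. *)
Lemma vanishes_torus_part f : vanishes torus_part f -> vanishes X f.
Proof.
move=> vf; have : vanishes X (f * h).
  move=> v Xv; rewrite mevalM; have [->|/torus_h tv] := eqVneq h.@[v] 0.
    by rewrite mulr0.
  by rewrite vf ?mul0r.
case/irrX => // vh; have [v [Xv /torus_h]] := torus_part_inh.
by rewrite vh ?eqxx.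
Qed.

Lemma zirreducible_torus_part : zirreducible torus_part.
Proof.
move=> f g /vanishes_torus_part /irrX.
by case=> vX; [left | right] => v [Xv _]; apply: vX.
Qed.

(* A binomial equation on the torus part extends to X; at a point of X whose only
   zero coordinate is one where the exponents differ, exactly one side vanishes. *)
Lemma torus_part_no_binomial k (le_k : (k <= n.+2)%N) (a b : 'X_{1..k}) : a != b ->
  ~ (forall y z, torus_part y -> torus_part z ->
      (\prod_i y (widen_ord le_k i) ^+ a i) * (\prod_i z (widen_ord le_k i) ^+ b i) =
      (\prod_i z (widen_ord le_k i) ^+ a i) * (\prod_i y (widen_ord le_k i) ^+ b i)).
Proof.
move=> neq_ab.
have [i neq_i] : exists i, a i != b i.
  apply/existsP; rewrite -negb_forall; apply: contra neq_ab => /forallP e.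
  by apply/eqP/mnmP => i; apply/eqP.
wlog lt_i : a b neq_ab neq_i / (b i < a i)%N.
  move=> W rel; case: (ltngtP (a i) (b i)) (neq_i) => // lt_i _.
    apply: (W b a) => //; [by rewrite eq_sym | by rewrite eq_sym |].
    by move=> y z Xy Xz; rewrite mulrC -rel // mulrC.
  exact: (W a b).
move=> rel; have [z Xz] := torus_part_inh.
have tz (m : 'X_{1..k}) : \prod_j z (widen_ord le_k j) ^+ m j != 0.
  by apply/prodf_neq0 => j _; rewrite expf_neq0 //; apply: (proj2 Xz).
(* Exponent subtraction is truncated, so the two monomials are coprime: their common factor, with
   exponents min(a, b), is cancelled. The coefficients are values at the fixed point [z]. *)
pose f : {mpoly F[n.+2]} :=
  (\prod_j z (widen_ord le_k j) ^+ b j) *: mlift le_k 'X_[a - b] -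
  (\prod_j z (widen_ord le_k j) ^+ a j) *: mlift le_k 'X_[b - a].
have fE v : f.@[v] =
    (\prod_j z (widen_ord le_k j) ^+ b j) * (\prod_j v (widen_ord le_k j) ^+ (a j - b j)) -
    (\prod_j z (widen_ord le_k j) ^+ a j) * (\prod_j v (widen_ord le_k j) ^+ (b j - a j)).
  rewrite mevalB !mevalZ !meval_mlift !mevalX; congr (_ * _ - _ * _);
    by apply: eq_bigr => j _; rewrite mnmBE.
have vf : vanishes X f.
  apply: vanishes_torus_part => y Xy; apply/eqP; rewrite fE subr_eq0.
  have nz : \prod_j y (widen_ord le_k j) ^+ (minn (a j) (b j)) != 0.
    by apply/prodf_neq0 => j _; rewrite expf_neq0 //; apply: (proj2 Xy).
  have split_min (c d : 'I_k -> nat) :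
      (\prod_j y (widen_ord le_k j) ^+ (c j - d j)) *
      (\prod_j y (widen_ord le_k j) ^+ minn (c j) (d j)) =
      \prod_j y (widen_ord le_k j) ^+ c j.
    rewrite -big_split; apply: eq_bigr => j _ /=; rewrite -exprD.
    by rewrite minnE subnKC // leq_subr.
  rewrite -(inj_eq (mulIf nz)) -!mulrA split_min.
  under [X in _ == _ * (_ * X)]eq_bigr do rewrite minnC.
  by rewrite split_min mulrC rel.
(* At this point the first monomial vanishes, as b i < a i, and the second has exponent 0 at [i], so
   it does not. *)
have [v [Xv vi vj]] := conciseX (widen_ord le_k i).
have /eqP := vf v Xv; rewrite fE [X in _ * X - _](bigD1 i) //= vi expr0n subn_eq0 leqNgt lt_i.
rewrite mul0r mulr0 sub0r oppr_eq0 mulf_eq0 (negPf (tz a)) /=.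
apply/negP/prodf_neq0 => j _; have [->|ji] := eqVneq j i.
  by rewrite (eqP (ltnW lt_i)) expr0 oner_neq0.
by rewrite expf_neq0 // vj // -val_eqE.
Qed.

Lemma torus_covered :
  (forall off, definable (fun e => torus_part (block off e))) ->
  forall q, torus q -> hprod (hpow torus_part n.+2) (hpow torus_part n.+2) q.
Proof.
move=> defX; apply: torus_sq_hpow => //.
- by move=> v [].
- exact: torus_part_inh.
- exact: zirreducible_torus_part.
- exact: torus_part_no_binomial.
Qed.

(** A formula holds finitely many equations, hence [finite_equations]. [S] describes [X] on the
    torus only, because the zero vector may satisfy [S] without lying in [X]. *)
Lemma definable_torus_part (S : {mpoly F[n.+2]} -> Prop) :
  (forall v, torus v -> (X v <-> forall p, S p -> p.@[v] = 0)) ->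
  forall off, definable (fun e => torus_part (block off e)).
Proof.
move=> XS off; have [s [sS sP]] := finite_equations S.
apply: definable_iff (definable_and (definable_all s (definable_meval off))
  (definable_not (definable_meval off h))) => e.
split=> [[es /eqP/torus_h te]|[Xe te]].
  by split=> //; apply/XS => //; apply: sP.
split=> [p /sS Sp|]; first by move/(XS _ te): Xe; apply.
by apply/eqP/torus_h.
Qed.

End TorusPart.

(** * Projective varieties *)

Section Variety.
Variables (N : nat) (X : projset N).
Hypothesis varX : irreducible_proj_variety X.
Implicit Types (f g : {mpoly CC[N.+1]}) (v : coordvec N).

Lemma variety_nonzero v : X v -> nonzero_vec v.
Proof. by case: varX => [[S [_ XS]] _ _] /XS[]. Qed.

Lemma variety_scale v (c : CC) : c != 0 -> X v -> X (fun i => c * v i).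
Proof.
case: varX => [[S [hS XS]] _ _] nzc /XS[[i vi] vS]; apply/XS; split.
  by exists i; rewrite mulf_neq0.
by move=> p Sp; have [d hd] := hS p Sp; rewrite (meval_homog_scale c v hd) vS ?mulr0.
Qed.

Lemma variety_homogeneous_nonvanishing f g : homogeneous f -> homogeneous g ->
  (exists v, X v /\ f.@[v] != 0) -> (exists v, X v /\ g.@[v] != 0) ->
  exists v, [/\ X v, f.@[v] != 0 & g.@[v] != 0].
Proof.
move=> hf hg [v [Xv fv]] [w [Xw gw]].
have closed_eq p : homogeneous p -> proj_closed (zero_locus (N := N) (fun q => q = p)).
  by move=> hp; exists (fun q => q = p); split=> // _ ->.
apply: Classical_Prop.NNPP => no; case: varX => _ _ irr.
case: (irr _ _ (closed_eq f hf) (closed_eq g hg)) => [u Xu|h|h].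
- have [fu|fu] := eqVneq f.@[u] 0.
    by left; split=> [|_ ->//]; apply: variety_nonzero.
  have [gu|gu] := eqVneq g.@[u] 0.
    by right; split=> [|_ ->//]; apply: variety_nonzero.
  by case: no; exists u.
- by have [_ /(_ f erefl) f0] := h v Xv; rewrite f0 eqxx in fv.
- by have [_ /(_ g erefl) g0] := h w Xw; rewrite g0 eqxx in gw.
Qed.

(** The components at [v] are the coefficients of [cone_poly v f], whose value at 1 is nonzero. *)
Lemma exists_pihomog_neq0 f v : f.@[v] != 0 ->
  exists d, (pihomog mdeg d f).@[v] != 0.
Proof.
move=> fv; apply: Classical_Prop.NNPP => no.
suff c0 : cone_poly v f = 0.
  have := horner_cone_poly v f 1; rewrite c0 horner0 => /esym/eqP.
  by rewrite (meval_eq _ (v2 := v)) ?(negPf fv) // => i; rewrite mul1r.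
apply/polyP => d; rewrite coef0 coef_cone_poly; apply/eqP/negPn/negP => nz.
by apply: no; exists d.
Qed.

(* Projective irreducibility only speaks of homogeneous equations; a general pair is
   reduced to homogeneous components, then separated along a line of the cone. *)
Lemma zirreducible_variety : zirreducible X.
Proof.
move=> f g vfg; apply: Classical_Prop.NNPP => /Classical_Prop.not_or_and.
case=> /not_vanishes [v [Xv fv]] /not_vanishes [w [Xw gw]].
have [d fd] := exists_pihomog_neq0 fv; have [e ge] := exists_pihomog_neq0 gw.
have homP k p : homogeneous (pihomog mdeg k p : {mpoly CC[N.+1]}).
  by exists k; exact: (dhomogP _ _ _ (pihomogP mdeg k p)).
have [z [Xz fz gz]] := variety_homogeneous_nonvanishing (homP d f) (homP e g)
  (ex_intro _ v (conj Xv fd)) (ex_intro _ w (conj Xw ge)).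
have nz_cone p k : (pihomog mdeg k p).@[z] != 0 -> cone_poly z p != 0.
  by apply: contraNneq => p0; rewrite -coef_cone_poly p0 coef0.
(* The factor ['X] forces [c] to be nonzero, so that c z stays in [X]. *)
have /closed_nonrootP [c] :
    'X * (cone_poly z f * cone_poly z g) != 0.
  by rewrite !mulf_neq0 ?polyX_eq0 ?(nz_cone f d) ?(nz_cone g e).
rewrite rootE !hornerM hornerX !mulf_eq0 !negb_or !horner_cone_poly => /and3P[nzc fc gc].
have := vfg _ (variety_scale nzc Xz).
by rewrite mevalM => /eqP; rewrite mulf_eq0 (negPf fc) (negPf gc).
Qed.

End Variety.

(** * Decompositions into points of the variety and the equivalence *)

Lemma hadamard_seq_mul N (a b : coordvec N) s :
  hadamard_seq (hadamard a b) s = hadamard a (hadamard_seq b s).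
Proof.
elim: s b => // x s IH b; rewrite /hadamard_seq /= -!/(hadamard_seq _ s) -IH.
congr hadamard_seq; apply: FunctionalExtensionality.functional_extensionality => i.
by rewrite /hadamard mulrA.
Qed.

Lemma hadamard_seq_eq0 N (p : coordvec N) s i :
  hadamard_seq p s i = 0 <-> exists x, (x = p \/ List.In x s) /\ x i = 0.
Proof.
elim: s p => [|y s IH] p.
  by split=> [p0|[x [[->|[]]]]] //; exists p; split; [left |].
rewrite /hadamard_seq /= -/(hadamard_seq _ s) hadamard_seq_mul.
have -> : (hadamard p (hadamard_seq y s) i = 0) <-> (p i = 0 \/ hadamard_seq y s i = 0).
  rewrite /hadamard; split=> [/eqP|[->|->]]; rewrite ?mul0r ?mulr0 //.
  by rewrite mulf_eq0 => /orP[]/eqP; [left | right].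
rewrite IH; split=> [[p0|[x [xs x0]]]|[x [[->|[<-|xs]] x0]]].
- by exists p; split; [left |].
- by exists x; split=> //; right; case: xs => [->|xs]; [left | right].
- by left.
- by right; exists y; split; [left |].
- by right; exists x; split; [right |].
Qed.

(** Equality is between coordinate vectors, so products compose without tracking scalars. *)
Definition is_hadamard_product N (X : projset N) (v : coordvec N) :=
  exists p s, [/\ X p, (forall x, List.In x s -> X x) & v =1 hadamard_seq p s].

Lemma is_hadamard_product_hprod N (X : projset N) (P Q : coordvec N -> Prop) v :
  (forall x, P x -> is_hadamard_product X x) ->
  (forall x, Q x -> is_hadamard_product X x) ->
  hprod P Q v -> is_hadamard_product X v.
Proof.
move=> PX QX [x [y [/PX[p [s [Xp Xs ex]]] /QX[p' [s' [Xp' Xs' ey]]] exy]]].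
exists p, (s ++ p' :: s'); split=> // [z zs|i].
  by case: (List.in_app_or _ _ _ zs) => [/Xs|[<-|/Xs']].
rewrite exy /hmul ex ey /hadamard_seq foldl_cat /= -!/(hadamard_seq _ _).
by rewrite hadamard_seq_mul.
Qed.

Lemma Hrk_finite_product N (X : projset N) (q : coordvec N) :
  nonzero_vec q -> is_hadamard_product X q -> Hrk_finite X q.
Proof.
move=> [i nzq] [p [s [Xp Xs e]]].
have Q0 : exists m, exists p s, size s = m.-1 /\ (0 < m)%N /\ Hdecomposition X q p s.
  exists (size s).+1, p, s; split=> //; split=> //; split=> //.
    by exists i; rewrite -e.
  by exists 1; split=> [|j]; rewrite ?oner_neq0 // mul1r e.
have [m [Qm minm]] := ex_minimal id Q0.
by exists m; split=> // m' p' s' sz m'0 D; apply: minm; exists p', s'.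
Qed.

Theorem mainTheorem1 (N : nat) (hN : (0 < N)%N) (X : projset N) :
  irreducible_proj_variety X ->
  ((forall q : coordvec N, nonzero_vec q -> Hrk_finite X q) <->
   strongly_concise X).
Proof.
case: N hN X => // n _ X varX; split=> [fin i sub | concise q nzq].
  (* The test point has a 0 at [i] and 1 elsewhere; [j0] shows that it is nonzero. *)
  have [j0 j0i] := exists_neq_ord i.
  have [m [[p [s [_ [_ [Xp Xs _ [c [nzc e]]]]]]] _]] :
      Hrk_finite X (fun j => (j != i)%:R).
    by apply: fin; exists j0; rewrite j0i oner_neq0.
  have hi : hadamard_seq p s i = 0.
    have := e i; rewrite eqxx => /esym/eqP.
    by rewrite mulf_eq0 (negPf nzc) => /eqP.
  (* A factor vanishing at [i] would also vanish at some other [j], and so would the product, where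
     the test point has a 1. *)
  have [x [xs xi]] := proj1 (hadamard_seq_eq0 p s i) hi.
  have Xx : X x by case: xs => [->|/Xs].
  have [j [ji xj]] := sub x (variety_nonzero varX Xx) Xx xi.
  have hj : hadamard_seq p s j = 0 by apply/hadamard_seq_eq0; exists x.
  by have /eqP := e j; rewrite ji hj mulr0 oner_eq0.
have irrX := zirreducible_variety varX.
have conciseX (i : 'I_n.+2) :
    exists v, [/\ X v, v i = 0 & forall j, j != i -> v j != 0].
  apply: Classical_Prop.NNPP => no; apply: (concise i) => v _ Xv vi.
  apply: Classical_Prop.NNPP => no'; apply: no; exists v; split=> // j ji.
  by apply/eqP => vj; apply: no'; exists j.
have powX k v : hpow (torus_part X) k v -> is_hadamard_product X v.
  elim: k v => [|k IH] v; first by case=> Xv _; exists v, [::].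
  apply: is_hadamard_product_hprod => // x [Xx _]; by exists x, [::].
have torusX v : torus v -> is_hadamard_product X v.
  move=> /(torus_covered irrX conciseX) cov.
  apply: is_hadamard_product_hprod (powX n.+2) (powX n.+2) (cov _).
  have [[S [_ XS]] _ _] := varX; apply: (definable_torus_part (S := S)) => w tw.
  split=> [/XS[]//|wS]; apply/XS; split=> //.
  by exists ord0; apply: tw.
apply: Hrk_finite_product => //.
(* Induction on a list of the zeros of [v]: split off a point [x] of [X] whose only zero is [i]; the
   quotient [w], set to 1 at [i], has one zero fewer. *)
have prodX (s : seq 'I_n.+2) (v : coordvec n.+1) :
    (forall i, (v i == 0) = (i \in s)) -> is_hadamard_product X v.
  elim: s v => [|i s IH] v vs; first by apply: torusX => i; rewrite vs.
  have [is_|is_] := boolP (i \in s).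
    by apply: IH => j; rewrite vs inE; case: eqP => // ->.
  have [x [Xx xi xj]] := conciseX i.
  pose w : coordvec n.+1 := fun j => if j == i then 1 else v j / x j.
  apply: (@is_hadamard_product_hprod _ X X (fun u => u = w)).
  - by move=> u Xu; exists u, [::].
  - move=> _ ->; apply: IH => j; rewrite /w; have [->|ji] := eqVneq j i.
      by rewrite oner_eq0 (negPf is_).
    by rewrite mulf_eq0 invr_eq0 (negPf (xj j ji)) orbF vs inE (negPf ji).
  exists x, w; split=> // j; rewrite /hmul /w; have [->|ji] := eqVneq j i.
    by rewrite xi mul0r; apply/eqP; rewrite vs mem_head.
  by rewrite mulrCA divff ?mulr1 // xj.
apply: (prodX [seq i <- enum 'I_n.+2 | q i == 0]) => i.
by rewrite mem_filter mem_enum andbT.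
Qed.
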